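(* Let $(a_1,\dots,a_n)$ and $(b_1,\dots,b_k)$ be non-increasing sequences of positive integers with $(a_1,\dots,a_n)\succ(b_1,\dots,b_k)$. Then each of the equations $$\sum_{i=1}^n ((a_i+1)!)^{1/(a_i+2)}=\sum_{i=1}^k ((b_i+1)!)^{1/(b_i+2)}$$ and $$\sum_{i=1}^n ((a_i+2)!)^{1/(a_i+2)}=\sum_{i=1}^k ((b_i+2)!)^{1/(b_i+2)}$$ holds only in the trivial case $n=k$ and $a_i=b_i$ for all $i$.
   Context: Majorization: for finite non-increasing sequences of positive integers $(a_1,\dots,a_n)$ and $(b_1,\dots,b_k)$, write $(a_1,\dots,a_n)\succ(b_1,\dots,b_k)$ if all of the following hold: (1) $n\le k$; (2) for every $i\le n$, $a_1+\dots+a_i\ge b_1+\dots+b_i$; (3) $a_1+\dots+a_n\ge b_1+\dots+b_k$. *)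

(* Defs.v *)
From mathcomp Require Import all_boot all_order all_algebra.
From mathcomp Require Import reals exp.

Set Implicit Arguments.
Unset Strict Implicit.
Unset Printing Implicit Defensive.

Definition noninc_pos (s : seq nat) : Prop :=
  sorted geq s /\ all (ltn 0) s.

Definition majorizes (a b : seq nat) : Prop :=
  [/\ size a <= size b,
      forall i : nat, i <= size a -> sumn (take i b) <= sumn (take i a)
    & sumn b <= sumn a].

(* Main.v *)
(** Positive real numbers [x_i] with [x_i ^ N] rational and pairwise irrational
    ratios are linearly independent over the rationals.  Indeed, after dividing a relation
    by some [x_i0], let the resulting radicals [y_i] act by multiplication on the
    finite-dimensional rational algebra they generate.  If [e] is least with [y_i ^ e]
    rational, ['X^e - y_i ^ e] is irreducible, so the characteristic polynomial
    of [y_i] is a polynomial in ['X^e] and [y_i] has trace 0 when [e > 1].  Taking the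
    trace of the relation kills the coefficient of [y_i0 = 1].

    The numbers [m! ^ (1 / (m + s))] have pairwise irrational ratios: a rational
    ratio forces the [p]-adic valuations [v_p(m!) / (m + s)], all less than 1,
    to agree, whereas these numbers are strictly increasing in [m]. *)
Require Import Defs.
From mathcomp Require Import all_boot all_order all_algebra algC zify.
From mathcomp Require Import boolp reals exp.

Set Implicit Arguments.
Unset Strict Implicit.
Unset Printing Implicit Defensive.

Import Order.TTheory GRing.Theory Num.Theory.
Local Open Scope ring_scope.

(** * Irreducibility of a pure binomial and the trace of a radical *)

(* The roots of ['X^e - c] all have modulus [y], so the constant term of a monic
   divisor of degree [k] has modulus [y ^ k]; hence [y ^ k] is rational. *)
Lemma size_dvd_XnsubC (F : realFieldType) (y : F) (e : nat) (c : rat)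
    (g : {poly rat}) :
  0 < y -> ratr c = y ^+ e -> (0 < e)%N ->
  (forall k q, (0 < k)%N -> y ^+ k = ratr q -> (e <= k)%N) ->
  g %| 'X^e - c%:P -> size g != 1%N -> (e < size g)%N.
Proof.
move=> y0 yc e0 emin gp sg.
have p0 : 'X^e - c%:P != 0 :> {poly rat} by rewrite -size_poly_eq0 size_XnsubC.
have g0 : g != 0 by apply: contraNneq p0 => g0; rewrite g0 dvd0p in gp.
have lg0 : lead_coef g != 0 by rewrite lead_coef_eq0.
pose gC := map_poly (ratr : rat -> algC) g.
have [r gr] := closed_field_poly_normal gC.
have lgC : lead_coef gC = ratr (lead_coef g) by rewrite lead_coef_map.
have lgC0 : lead_coef gC != 0 by rewrite lgC fmorph_eq0.
have sgr : size g = (size r).+1.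
  transitivity (size gC); first by rewrite size_map_poly.
  by rewrite gr size_scale // size_prod_XsubC.
have r0 : (0 < size r)%N by move: sg; rewrite sgr; case: (size r).
rewrite sgr ltnS.
have zc z : z \in r -> `|z| ^+ e = `|ratr c|.
  move=> zr.
  have : root (map_poly (ratr : rat -> algC) ('X^e - c%:P)) z.
    case/dvdpP: gp => h ->; rewrite rmorphM rootM /= -/gC gr.
    by rewrite rootZ // root_prod_XsubC zr orbT.
  rewrite rmorphB /= map_polyXn map_polyC /root hornerD hornerN hornerXn hornerC.
  by rewrite subr_eq0 => /eqP <-; rewrite normrX.
pose h := g`_0 / lead_coef g.
have hC : `|ratr h : algC| = \prod_(z <- r) `|z|.
  have -> : ratr h = (\prod_(z <- r) ('X - z%:P)).[0] :> algC.
    rewrite fmorph_div /= -lgC.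
    have -> : ratr g`_0 = gC.[0] by rewrite horner_coef0 coef_map.
    by rewrite {1}gr hornerZ mulrAC mulfV // mul1r.
  rewrite horner_prod normr_prod; apply: eq_bigr => z _.
  by rewrite hornerXsubC sub0r normrN.
(* The roots lie in [algC] and [y] in [F], so moduli are compared through [e]-th powers, which are
   rational on both sides. *)
have hc : `|h| ^+ e = `|c| ^+ size r.
  apply: (fmorph_inj (ratr : {rmorphism rat -> algC})).
  rewrite !rmorphXn /= !ratr_norm hC -prodrXl big_seq (eq_bigr (fun=> `|ratr c|)).
    by rewrite -big_seq big_const_seq count_predT iter_mulr_1.
  by move=> z /zc.
apply: (emin _ `|h|) => //.
apply/eqP; rewrite -(@eqrXn2 _ e) ?ler0q ?exprn_ge0 ?(ltW y0) //.
rewrite -rmorphXn hc rmorphXn /= ratr_norm yc normrX gtr0_norm //.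
by rewrite -!exprM mulnC.
Qed.

(** Strong induction on the degree. A nonconstant [p] shares a root with ['X^e - c], so their gcd is
    a nonconstant factor of an irreducible polynomial and hence all of it. The quotient inherits the
    condition on roots. *)
Lemma comp_Xn_of_roots (F : realFieldType) (y : F) (e : nat) (c : rat)
    (p : {poly rat}) :
  0 < y -> ratr c = y ^+ e -> (0 < e)%N ->
  (forall k q, (0 < k)%N -> y ^+ k = ratr q -> (e <= k)%N) ->
  p != 0 ->
  (forall z : algC, root (map_poly ratr p) z -> z ^+ e = ratr c) ->
  exists q : {poly rat}, p = q \Po 'X^e.
Proof.
move=> y0 yc e0 emin; have [n] := ubnP (size p).
elim: n p => // n IH p; rewrite ltnS => sp p0 rp.
have [sp1|sp1] := eqVneq (size p) 1%N.
  have /size_poly1P[a _ ->] : size p == 1%N by rewrite sp1.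
  by exists a%:P; rewrite comp_polyC.
pose d := 'X^e - c%:P : {poly rat}.
have sd : size d = e.+1 by rewrite size_XnsubC.
have d0 : d != 0 by rewrite -size_poly_eq0 sd.
have dp : d %| p.
  have /closed_rootP[z rz] : size (map_poly (ratr : rat -> algC) p) != 1%N.
    by rewrite size_map_poly.
  have rg : root (map_poly (ratr : rat -> algC) (gcdp p d)) z.
    rewrite gcdp_map root_gcd rz /= rmorphB /= map_polyXn map_polyC /root.
    by rewrite hornerD hornerN hornerXn hornerC (rp _ rz) subrr.
  have sg : size (gcdp p d) != 1%N.
    apply: contraTneq rg => sg.
    have /size_poly1P[a a0 ->] : size (gcdp p d) == 1%N by rewrite sg.
    by rewrite map_polyC rootC fmorph_eq0.
  have := size_dvd_XnsubC y0 yc e0 emin (dvdp_gcdr p d) sg.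
  rewrite -sd => sdg.
  have : gcdp p d %= d.
    rewrite -dvdp_size_eqp ?dvdp_gcdr // eqn_leq sdg andbT.
    by rewrite dvdp_leq // dvdp_gcdr.
  by move/eqp_dvdl <-; exact: dvdp_gcdl.
case/dvdpP: dp => p' pE.
have p'0 : p' != 0 by apply: contraNneq p0 => p'0; rewrite pE p'0 mul0r.
have [|//||q qE] := IH p'.
- apply: leq_trans sp; rewrite pE size_mul // sd addnS /= -addn1 leq_add2l //.
- by move=> z rz; apply: rp; rewrite pE rmorphM rootM rz.
exists (q * ('X - c%:P)); rewrite pE qE comp_polyM; congr (_ * _).
by rewrite comp_polyB comp_polyX comp_polyC.
Qed.

(** Every eigenvalue [z] satisfies [z ^ e = c], so the characteristic polynomial is a polynomial in
    ['X^e]. Its degree [n + 1] is a multiple of [e > 1], so [n] is not, and the coefficient of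
    ['X^n], which is minus the trace, vanishes. *)
Lemma mxtrace_radical (F : realFieldType) (y : F) (e n : nat) (c : rat)
    (A : 'M[rat]_n.+1) :
  0 < y -> ratr c = y ^+ e -> (1 < e)%N ->
  (forall k q, (0 < k)%N -> y ^+ k = ratr q -> (e <= k)%N) ->
  A ^+ e = c%:M -> \tr A = 0.
Proof.
move=> y0 yc e1 emin Ae; have e0 := ltnW e1.
have mA := char_poly_monic A.
have [||q qE] := comp_Xn_of_roots (p := char_poly A) y0 yc e0 emin.
- exact: monic_neq0.
- move=> z; rewrite map_char_poly -eigenvalue_root_char => /eigenvalueP[v vA v0].
  have vAk k : v *m (map_mx ratr A) ^+ k = z ^+ k *: v.
    elim: k => [|k IH]; first by rewrite !expr0 mulmx1 scale1r.
    by rewrite exprSr mulmxA IH -scalemxAl vA scalerA exprSr.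
  have := vAk e; rewrite -rmorphXn Ae /= map_scalar_mx mul_mx_scalar => /eqP.
  rewrite -subr_eq0 -scalerBl scaler_eq0 (negbTE v0) orbF subr_eq0.
  by move=> /eqP.
have sA := size_char_poly A.
have en : (e %| n.+1)%N.
  have : (char_poly A)`_n.+1 != 0.
    by move/monicP: mA; rewrite lead_coefE sA => ->; exact: oner_neq0.
  by rewrite qE coef_comp_poly_Xn //; case: ifP => //; rewrite eqxx.
have := char_poly_trace A isT; rewrite {1}qE coef_comp_poly_Xn //= ifF.
  by move/eqP; rewrite eq_sym oppr_eq0 => /eqP.
apply: contraTF en => en; rewrite -addn1 dvdn_addr //.
by rewrite dvdn1 gtn_eqF.
Qed.

(** * Radicals acting as rational matrices *)

Definition rat_independent (F : fieldType) (n : nat) (w : 'cV[F]_n) : Prop :=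
  forall v : 'rV[rat]_n, map_mx ratr v *m w = 0 -> v = 0.

(** This makes the rational matrix of a multiplication unique, so that relations between numbers
    carry over to their matrices. *)
Lemma rat_independent_mx (F : numFieldType) (m n : nat) (w : 'cV[F]_n)
    (A : 'M[rat]_(m, n)) :
  rat_independent w -> map_mx ratr A *m w = 0 -> A = 0.
Proof.
move=> iw Aw; apply/row_matrixP => i; rewrite row0; apply: iw.
by rewrite map_row -row_mul Aw row0.
Qed.

(* A relation among the entries of [w] lets us drop one of them; [D] deletes it and
   [E] recovers it. *)
Lemma rat_stable_independent (F : numFieldType) (I : Type) (y : I -> F)
    (n : nat) (w : 'cV[F]_n) :
  w != 0 ->
  (forall i, exists A : 'M[rat]_n, y i *: w = map_mx ratr A *m w) ->
  exists m (u : 'cV[F]_m.+1), rat_independent u /\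
    forall i, exists A : 'M[rat]_m.+1, y i *: u = map_mx ratr A *m u.
Proof.
elim: n w => [|n IH] w w0 hw.
  by move: w0; rewrite [w]flatmx0 eqxx.
have [iw|] := pselect (rat_independent w); first by exists n, w.
move/existsNP => [v /not_implyP[vw /eqP v0]].
have /rV0Pn[j vj] := v0.
pose D : 'M[rat]_(n, n.+1) := row' j 1%:M.
pose E : 'M[rat]_(n.+1, n) := \matrix_(a, k)
  if unlift j a is Some k' then (k' == k)%:R else - (v 0 (lift j k) / v 0 j).
have wE : w = map_mx ratr E *m (map_mx ratr D *m w).
  have Dw k l : (map_mx ratr D *m w) k l = w (lift j k) l.
    rewrite mxE (bigD1 (lift j k)) //= big1 => [|i ik].
      by rewrite !mxE eqxx rmorph1 mul1r addr0.
    by rewrite !mxE eq_sym (negbTE ik) rmorph0 mul0r.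
  apply/matrixP => a l; rewrite mxE.
  under eq_bigr => k _ do rewrite Dw !mxE.
  case: unliftP => [k'|] ->.
    rewrite (bigD1 k') //= big1 => [|i ik].
      by rewrite eqxx rmorph1 mul1r addr0.
    by rewrite eq_sym (negbTE ik) rmorph0 mul0r.
  move/matrixP/(_ 0 l): vw; rewrite !mxE (bigD1_ord j) //= !mxE => /eqP.
  rewrite addrC addr_eq0 => /eqP vw.
  have rvj : ratr (v 0 j) != 0 :> F by rewrite fmorph_eq0.
  apply: (mulfI rvj); rewrite -[LHS]opprK -vw mulr_sumr -sumrN.
  apply: eq_bigr => k _; rewrite !mxE rmorphN fmorph_div /= mulNr mulrN.
  by congr (- _); rewrite mulrA mulrCA mulfV // mulr1.
apply: (IH (map_mx ratr D *m w)).
  by apply: contraNneq w0 => Dw; rewrite wE Dw mulmx0.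
(* Since [w = E D w], multiplication by [y i] sends [D w] to [D A w = (D A E) (D w)]. *)
move=> i; have [A Aw] := hw i; exists (D *m A *m E).
by rewrite scalemxAr Aw !map_mxM -!mulmxA -wE.
Qed.

(** The entries of [w] are the monomials in the [y i] with all exponents at most [N]. Multiplication
    by [y i] shifts one exponent cyclically, and wrapping from [N] to 0 costs the rational factor
    [q i]. *)
Lemma radicals_rat_stable (F : numFieldType) (I : finType) (y : I -> F)
    (N : nat) (q : I -> rat) :
  (forall i, y i != 0) -> (forall i, y i ^+ N.+1 = ratr (q i)) ->
  exists n (w : 'cV[F]_n), w != 0 /\
    forall i, exists A : 'M[rat]_n, y i *: w = map_mx ratr A *m w.
Proof.
move=> y0 yN; pose T : finType := {ffun I -> 'I_N.+1}.
pose mon (e : T) : F := \prod_i y i ^+ e i.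
pose w : 'cV[F]_#|T| := \col_k mon (enum_val k).
exists #|T|, w; split.
  apply/cV0Pn; exists (enum_rank ([ffun=> ord0] : T)).
  by rewrite mxE; apply/prodf_neq0 => i _; rewrite expf_neq0.
move=> i.
pose next (e : T) : T := [ffun j => if j == i then ordS (e j) else e j].
pose coef (e : T) : rat := if (e i).+1 == N.+1 then q i else 1.
have mon_next e : y i * mon e = ratr (coef e) * mon (next e).
  rewrite /mon (bigD1 i) //= [in RHS](bigD1 i) //= !mulrA; congr (_ * _).
    rewrite -exprS /next ffunE eqxx /coef /=; case: eqP => [eN|/eqP eN].
      by rewrite eN modnn expr0 mulr1 yN.
    by rewrite rmorph1 mul1r modn_small // ltn_neqAle eN /=.
  by apply: eq_bigr => j /negbTE ji; rewrite ffunE ji.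
exists (\matrix_(k, l)
  if l == enum_rank (next (enum_val k)) then coef (enum_val k) else 0).
apply/matrixP => k l; rewrite !mxE mon_next.
rewrite (bigD1 (enum_rank (next (enum_val k)))) //= big1 => [|j jk].
  by rewrite !mxE eqxx enum_rankK addr0.
by rewrite !mxE (negbTE jk) rmorph0 mul0r.
Qed.

Lemma radicals_rat_independent (F : realFieldType) (I : finType) (x : I -> F)
    (N : nat) (q c : I -> rat) :
  (forall i, 0 < x i) -> (forall i, x i ^+ N.+1 = ratr (q i)) ->
  (forall i j r, x i / x j = ratr r -> i = j) ->
  \sum_i ratr (c i) * x i = 0 -> forall i, c i = 0.
Proof.
move=> x0 xN xirr sumx i0.
pose y i := x i / x i0.
have y0 i : 0 < y i by rewrite divr_gt0.
have yN i : y i ^+ N.+1 = ratr (q i / q i0).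
  by rewrite expr_div_n !xN fmorph_div.
have [|n0 [w0 [w00 hw0]]] := radicals_rat_stable (y := y) _ yN.
  by move=> i; rewrite gt_eqF.
have [n [w [iw /choice[A Aw]]]] := rat_stable_independent w00 hw0.
have Apow i e : y i ^+ e *: w = map_mx ratr (A i ^+ e) *m w.
  elim: e => [|e IH]; first by rewrite !expr0 map_mx1 mul1mx scale1r.
  by rewrite !exprS map_mxM -mulmxA -IH -scalemxAr -Aw scalerA mulrC.
have Ascal i e r : y i ^+ e = ratr r -> A i ^+ e = r%:M.
  move=> yr; apply/eqP; rewrite -subr_eq0; apply/eqP.
  apply: (rat_independent_mx iw).
  by rewrite map_mxB mulmxBl -Apow map_scalar_mx mul_scalar_mx yr subrr.
have trA i : i != i0 -> \tr (A i) = 0.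
  move=> ii0.
  pose P e := (0 < e)%N && `[< exists r, y i ^+ e = ratr r >].
  have exP : exists e, P e.
    by exists N.+1; apply/andP; split => //; apply/asboolP; exists (q i / q i0).
  case: (ex_minnP exP) => e /andP[e0 /asboolP[r yr]] emin.
  (* With [e = 1] the ratio [x i / x i0] itself would be rational, forcing [i = i0]. *)
  have e1 : (1 < e)%N.
    rewrite ltn_neqAle e0 andbT; apply: contraNneq ii0 => e1.
    by apply/eqP/(xirr _ _ r); rewrite -yr -e1 expr1.
  apply: (mxtrace_radical (y0 i) (esym yr) e1 _ (Ascal _ _ _ yr)).
  by move=> k s k0 ys; apply: emin; rewrite /P k0; apply/asboolP; exists s.
have A1 : A i0 = 1%:M.
  by have := Ascal i0 1%N 1; rewrite !expr1 => -> //; rewrite rmorph1 /y divff ?gt_eqF.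
have sumA : \sum_i c i *: A i = 0.
  apply: (rat_independent_mx iw).
  rewrite map_mx_sum mulmx_suml.
  under eq_bigr => i _ do rewrite map_mxZ -scalemxAl -Aw scalerA.
  rewrite -scaler_suml.
  under eq_bigr => i _ do rewrite mulrA.
  by rewrite -mulr_suml sumx mul0r scale0r.
(* Only the term of [i0] survives, and it equals [c i0] times the nonzero dimension [n + 1]. *)
have := congr1 mxtrace sumA; rewrite mxtrace0 raddf_sum /= (bigD1 i0) //=.
rewrite big1 => [|i ii0]; last by rewrite mxtraceZ trA // mulr0.
rewrite addr0 mxtraceZ A1 mxtrace1 => /eqP.
by rewrite mulf_eq0 pnatr_eq0 orbF => /eqP.
Qed.

(** * Valuations and growth of factorials *)

Lemma logn_fact_lt (p m : nat) : prime p -> (0 < m)%N -> (logn p m`! < m)%N.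
Proof.
move=> pp m0; rewrite logn_fact //.
(* Legendre's formula compared with a geometric series of ratio [1 / 2]. *)
have H K : ((\sum_(1 <= k < K.+1) m %/ p ^ k) * 2 ^ K + m <= m * 2 ^ K)%N.
  elim: K => [|K IH]; first by rewrite big_geq // mul0n expn0 muln1.
  rewrite big_nat_recr //= mulnDl.
  have : (m %/ p ^ K.+1 * 2 ^ K.+1 <= m)%N.
    apply: leq_trans (leq_divM m (p ^ K.+1)).
    by rewrite leq_mul2l leq_exp2r // prime_gt1 ?orbT.
  move: IH; rewrite !expnS; set S := (\sum_(_ <= _ < _) _)%N; lia.
have /leq_trans := H m.
rewrite -(ltn_pmul2r (expn_gt0 2 m)) => /(_ _ (leqnn _)).
by apply: leq_trans; rewrite -addn1 leq_add2l.
Qed.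

Lemma fact_leq_exp (m l : nat) : (m <= l -> m`! <= l ^ m)%N.
Proof.
elim: m => // m IH ml; rewrite factS expnS leq_mul //; exact: IH (ltnW ml).
Qed.

(** Strict growth of [m! ^ (1 / (m + s))], cleared of roots. Raising [l] by one multiplies the left
    side by [m!] and the right side by [(l + 1) ^ (m + s)], which is larger because
    [m! <= l ^ m]. *)
Lemma fact_exp_lt (s m l : nat) :
  (0 < m)%N -> (m < l)%N -> (m`! ^ (l + s) < l`! ^ (m + s))%N.
Proof.
move=> m0; elim: l => // l IH; rewrite ltnS => ml.
have l0 : (0 < l)%N by exact: leq_trans ml.
have mle : (m`! < l.+1 ^ (m + s))%N.
  apply: (@leq_ltn_trans (l ^ m)); first exact: fact_leq_exp.
  apply: (@leq_trans (l.+1 ^ m)); first by rewrite ltn_exp2r.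
  by rewrite leq_pexp2l // leq_addr.
rewrite addSn expnS factS expnMn; move: ml; rewrite leq_eqVlt => /orP[/eqP ml|ml].
  by rewrite -ml in mle *; rewrite ltn_pmul2r ?expn_gt0 ?fact_gt0.
by apply: ltn_mul => //; exact: IH.
Qed.

(** The parameter [s] serves both equations: [s = 1] at [m = x + 1] gives the first, [s = 0] at
    [m = x + 2] the second. *)
Definition fact_root (R : realType) (s m : nat) : R :=
  (m`!)%:R `^ ((m + s)%:R^-1).

Lemma fact_root_gt0 (R : realType) (s m : nat) : 0 < fact_root R s m.
Proof. by rewrite powR_gt0 // ltr0n fact_gt0. Qed.

Lemma fact_rootX (R : realType) (s m : nat) :
  (0 < m)%N -> fact_root R s m ^+ (m + s) = (m`!)%:R.
Proof.
move=> m0; rewrite -powR_mulrn ?ltW ?fact_root_gt0 // -powRrM mulVf ?powRr1 //.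
by rewrite pnatr_eq0 -lt0n addn_gt0 m0.
Qed.

Lemma fact_root_ratio (R : realType) (s m l : nat) (r : rat) :
  (0 < m)%N -> (0 < l)%N -> fact_root R s m / fact_root R s l = ratr r -> m = l.
Proof.
move=> m0 l0 mlr.
have r0 : 0 < r.
  by rewrite -(ltr0q R) -mlr divr_gt0 ?fact_root_gt0.
pose u := `|numq r|%N; pose v := `|denq r|%N.
have u0 : (0 < u)%N by rewrite absz_gt0 numq_eq0 gt_eqF.
have v0 : (0 < v)%N by rewrite absz_gt0 denq_eq0.
have ruv : ratr r = u%:R / v%:R :> R.
  by rewrite /ratr /u /v !natr_absz !ger0_norm // ltW // numq_gt0.
pose D := ((m + s) * (l + s))%N.
(* The ratio [u / v] raised to the power [D], which clears both roots at once. *)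
have uvE : (m`! ^ (l + s) * v ^ D = l`! ^ (m + s) * u ^ D)%N.
  apply/eqP; rewrite -(eqr_nat R) !natrM !natrX -!(fact_rootX R s) // -!exprM.
  rewrite [((l + s) * _)%N]mulnC -/D -!exprMn; apply/eqP; congr (_ ^+ _).
  have -> : fact_root R s m = fact_root R s l * (u%:R / v%:R).
    by rewrite -ruv -mlr mulrC divfK // gt_eqF ?fact_root_gt0.
  by rewrite -mulrA divfK // pnatr_eq0 -lt0n.
have vp p : prime p -> logn p (m`! ^ (l + s)) = logn p (l`! ^ (m + s)).
  move=> pp; have := congr1 (logn p) uvE.
  rewrite !lognM ?expn_gt0 ?fact_gt0 ?u0 ?v0 // (lognX _ v) (lognX _ u).
  have : (logn p (m`! ^ (l + s)) < D)%N.
    rewrite lognX /D mulnC ltn_pmul2r ?addn_gt0 ?l0 //.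
    exact: leq_trans (logn_fact_lt pp m0) (leq_addr _ _).
  have : (logn p (l`! ^ (m + s)) < D)%N.
    rewrite lognX ltn_pmul2l ?addn_gt0 ?m0 //.
    exact: leq_trans (logn_fact_lt pp l0) (leq_addr _ _).
  (* The two valuations are below [D] and differ by a multiple of [D], so reduction modulo [D]
     identifies them. *)
  move: (logn p (m`! ^ _)) (logn p (l`! ^ _)) (D) => A B D' BD AD AB.
  have := congr1 (modn^~ D') AB.
  by rewrite /= ![(D' * _)%N]mulnC ![(_ + _ * D')%N]addnC !modnMDl !modn_small.
have facE : (m`! ^ (l + s) = l`! ^ (m + s))%N.
  apply: eqn_from_log; rewrite ?expn_gt0 ?fact_gt0 // => p /=.
  have [pp|/negbTE np] := boolP (prime p); first exact: vp.
  by rewrite [LHS]lognE [RHS]lognE np.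
case: (ltngtP m l) => // [ml|lm].
  by have := fact_exp_lt s m0 ml; rewrite facE ltnn.
by have := fact_exp_lt s l0 lm; rewrite facE ltnn.
Qed.

(** * From equal sums to equal sequences *)

(** Grouping equal terms turns the equality into a rational relation whose coefficients are
    differences of multiplicities; independence makes them all zero. *)
Lemma sum_fact_root_inj (R : realType) (s : nat) (a b : seq nat) :
  all (ltn 0) a -> all (ltn 0) b ->
  \sum_(x <- a) fact_root R s x = \sum_(x <- b) fact_root R s x ->
  perm_eq a b.
Proof.
move=> a0 b0 sumE.
pose t := undup (a ++ b); pose I := seq_sub t.
have t0 (i : I) : (0 < val i)%N.
  have := valP i; rewrite mem_undup mem_cat => /orP[ia|ib].
    exact: (allP a0).
  exact: (allP b0).
have sum_count r : {subset r <= t} -> \sum_(x <- r) fact_root R s x =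
    \sum_(i : I) (count_mem (val i) r)%:R * fact_root R s (val i).
  elim: r => [|x r IH] rt.
    by rewrite big_nil big1 // => i _; rewrite mul0r.
  rewrite big_cons IH => [|z zr]; last by apply: rt; rewrite inE zr orbT.
  have xt : x \in t by apply: rt; rewrite mem_head.
  rewrite /=; under [RHS]eq_bigr => i _ do rewrite natrD mulrDl.
  rewrite big_split /=; congr (_ + _).
  rewrite (bigD1 (SeqSub xt)) //= eqxx mul1r big1 ?addr0 // => i ix.
  by rewrite -val_eqE /= eq_sym in ix; rewrite (negbTE ix) mul0r.
(* A common exponent: each [val i + s] divides [N], so every [N]-th power is an integer. *)
pose N := (\prod_(i : I) (val i + s))%N.
have N0 : (0 < N)%N by rewrite prodn_gt0 // => i; rewrite addn_gt0 t0.
have xN (i : I) : fact_root R s (val i) ^+ N.-1.+1 =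
    ratr (((val i)`!)%:R ^+ (N %/ (val i + s))).
  rewrite prednK // rmorphXn /= ratr_nat -(fact_rootX R s (t0 i)) -exprM mulnC.
  by rewrite divnK // /N (bigD1 i) //= dvdn_mulr.
pose c (i : I) : rat := (count_mem (val i) a)%:R - (count_mem (val i) b)%:R.
have c0 : forall i, c i = 0.
  apply: (radicals_rat_independent _ xN) => [i|i j r|].
  - exact: fact_root_gt0.
  - by move=> /(fact_root_ratio (t0 i) (t0 j)) /val_inj.
  - under eq_bigr => i _ do rewrite rmorphB /= !ratr_nat mulrBl.
    rewrite sumrB -!sum_count ?sumE ?subrr // => x xab;
      by rewrite mem_undup mem_cat xab ?orbT.
apply/allP => x; rewrite -mem_undup => xt.
have := c0 (SeqSub xt); rewrite /c /= => /eqP.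
by rewrite subr_eq0 eqr_nat.
Qed.

Lemma sum_fact_root_sorted (R : realType) (s d : nat) (a b : seq nat) :
  noninc_pos a -> noninc_pos b ->
  \sum_(x <- a) fact_root R s (x + d) = \sum_(x <- b) fact_root R s (x + d) ->
  a = b.
Proof.
move=> [sa a0] [sb b0] sumE.
apply: (sorted_eq _ _ sa sb).
- by move=> y x z /= yx zy; exact: leq_trans zy yx.
- by move=> x y /=; rewrite andbC -eqn_leq => /eqP.
apply: (perm_map_inj (@addIn d)); apply: (sum_fact_root_inj (R := R) (s := s)).
- by rewrite all_map; apply: sub_all a0 => x /= x0; rewrite ltn_addr.
- by rewrite all_map; apply: sub_all b0 => x /= x0; rewrite ltn_addr.
by rewrite !big_map.
Qed.

Theorem theorem3p4 (R : realType) (a b : seq nat)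
    (ha : noninc_pos a) (hb : noninc_pos b) (hab : majorizes a b) :
  (\sum_(x <- a) (((x + 1)`!)%:R : R) `^ ((x + 2)%:R^-1)
     = \sum_(x <- b) (((x + 1)`!)%:R : R) `^ ((x + 2)%:R^-1)
   -> a = b)
  /\
  (\sum_(x <- a) (((x + 2)`!)%:R : R) `^ ((x + 2)%:R^-1)
     = \sum_(x <- b) (((x + 2)`!)%:R : R) `^ ((x + 2)%:R^-1)
   -> a = b).
Proof.
split=> sumE; [apply: (sum_fact_root_sorted (R := R) (s := 1) (d := 1) ha hb)
              |apply: (sum_fact_root_sorted (R := R) (s := 0) (d := 2) ha hb)].
  by under eq_bigr do rewrite /fact_root -addnA; under [RHS]eq_bigr do rewrite /fact_root -addnA.
by under eq_bigr do rewrite /fact_root addn0; under [RHS]eq_bigr do rewrite /fact_root addn0.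
Qed.
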